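(* Let $R$ be a finite group. In the action of $\mathrm{Aut}(R)$ on $\mathrm{Sub}(R)$ there exists a regular orbit (that is, an orbit on which the permutation group $\mathrm{A}(R)$ induced by $\mathrm{Aut}(R)$ on $\mathrm{Sub}(R)$ acts regularly) if and only if $R$ is cyclic.
   Context: $\mathrm{Aut}(R)$ is the automorphism group of $R$ and $\mathrm{Sub}(R)$ is the set of all subgroups of $R$. $\mathrm{Aut}(R)$ acts on $\mathrm{Sub}(R)$ by sending $H\in\mathrm{Sub}(R)$ to its image $H^\alpha$ under $\alpha\in\mathrm{Aut}(R)$. $\mathrm{A}(R)$ denotes the permutation group on $\mathrm{Sub}(R)$ induced by this action, i.e. the image of $\mathrm{Aut}(R)$ in the symmetric group on $\mathrm{Sub}(R)$. An orbit is regular if $\mathrm{A}(R)$ acts on it transitively with trivial point stabilizers, where stabilizers are taken in $\mathrm{A}(R)$ (the permutation group on the whole of $\mathrm{Sub}(R)$, not merely its restriction to the orbit). *)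

(* Defs.v *)
From mathcomp Require Import all_boot all_fingroup all_solvable.

Set Implicit Arguments.
Unset Strict Implicit.
Unset Printing Implicit Defensive.

Local Open Scope group_scope.

(* Sub(R), with subgroups seen as sets of elements: an automorphism of R is a *)
(* permutation of gT that need not preserve the subgroups of gT outside R, so *)
(* Aut(R) acts on {set gT} but not on {group gT}.                             *)
Definition SubR (gT : finGroupType) (R : {group gT}) : {set {set gT}} :=
  [set gval H | H in subgroups R].

Lemma Aut_acts_SubR (gT : finGroupType) (R : {group gT}) :
  [acts Aut R, on SubR R | 'P^*].
Proof.
apply/subsetP=> a Aa; rewrite !inE /=; apply/subsetP=> _ /imsetP[H sHR ->].
have {}sHR: H \subset R by rewrite inE in sHR.
have im_aH: 'P^*%act H a = autm Aa @* H.
  by rewrite morphimEsub //; apply: eq_imset.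
rewrite inE; apply/imsetP; exists (autm Aa @* H)%G => //=.
by rewrite inE (subset_trans (morphimS _ sHR)) // im_autm.
Qed.

(* A(R), the image of Aut(R) in the symmetric group on Sub(R). The action on  *)
(* Sub(R) is extended by the identity to the other sets, so Sym(Sub(R)) is    *)
(* seen as the permutations of {set gT} with support in Sub(R).               *)
Definition AR (gT : finGroupType) (R : {group gT}) : {group {perm {set gT}}} :=
  (actperm <[Aut_acts_SubR R]> @* Aut R)%G.

Definition regular_on (aT : finGroupType) (rT : finType)
    (to : {action aT &-> rT}) (G : {group aT}) (S : {set rT}) : Prop :=
  [transitive G, on S | to] /\ forall x, x \in S -> 'C_G[x | to] = 1.

(* Main.v *)
Require Import Defs.
From mathcomp Require Import all_boot all_fingroup all_solvable.

(** Call a subgroup H of R rigid when every automorphism of R that stabilises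
    H fixes every subgroup of R. A regular orbit of the induced permutation
    group on the subgroups of R is exactly the orbit of a rigid subgroup. If R
    is cyclic all its subgroups are characteristic, the permutation group is
    trivial, and the orbit of R itself is regular. The content is the
    converse: a group with a rigid subgroup is cyclic.

    Conjugation by an element of K = N_R(H) stabilises H, so K normalises
    every subgroup of R, and K is normal in R. The computation that drives
    everything is [norm_commg_l]: for x in K and g in R, the commutator [x, g]
    commutes with x and with g. Indeed [x, g x] = [x, g]^x lies in both <g>
    and <g x>, hence commutes with g and g x, hence with x. So x and g commute
    when their orders are coprime; this makes [g, y] centralise H when g and y
    have coprime orders, so [g, y] lies in C_R(H), which K contains, and one
    more use of the commutator identities gives [g, y] = 1. Thus R is nilpotent
    ([rigid_nilpotent]), rigidity passes to the Sylow subgroups, and R may be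
    taken to be a p-group P, noncyclic for a contradiction, with H proper.

    Inside P, the only automorphisms needed besides conjugations are shears
    ([shear_automorphism]): if M is normal of prime index p, g is outside M, c
    is in Z(M) and (g c)^p = g^p, then there is an automorphism that is the
    identity on M and sends g to g c. When M contains H, rigidity forces c to
    be a power of g ([rigid_shear]). Central c of order p show that P has a
    single central subgroup <z> of order p, and that z lies in <g> for all g
    outside a maximal subgroup containing H. Hence [k, P] is contained in <z>
    for k in K of order p, and C_P(k) is maximal and contains H unless k lies
    in <z>. For odd p, the shear by k over C_P(k) is a contradiction, so K has
    a single subgroup of order p and is cyclic; then H is normal in P and
    P = K is cyclic ([rigid_not_odd]).

    For p = 2 one has (g k)^2 = g^2 z instead, and more is needed. If K is
    abelian and has an involution k other than z, shears show that z has no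
    square root in K, then that K has exponent 2; for g not commuting with k
    the square g^2 centralises H, so lies in K, and g^2 = z; but then
    (g k)^2 = 1, although z is a power of g k
    ([second_involution_absurd]). If K is not abelian, then, all its subgroups
    being normal, it contains x and y with x^2 = y^2 = [x, y] of order 2
    ([dedekind_quaternion_pair]). One finds [x, y] = z and P = <x, y> C_P(x, y),
    with C_P(x, y) inside every maximal subgroup M that contains H; a shear
    over M by an element of order 4 of <x, y> is again a contradiction. *)

Set Implicit Arguments.
Unset Strict Implicit.
Unset Printing Implicit Defensive.

Local Open Scope group_scope.

(** * Cyclic subgroups, maximal subgroups and arithmetic *)

Lemma mem_cycle_prime (gT : finGroupType) (g z t : gT) p :
  prime p -> #[z] = p -> z \in <[g]> -> t \in <[g]> -> t ^+ p = 1 -> t \in <[z]>.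
Proof.
move=> pr_p oz gz gt tp1; have [-> | nt_t] := eqVneq t 1; first exact: group1.
have ot : #[t] = p by apply: nt_prime_order.
rewrite -cycle_subG; suffices /eqP-> : <[t]> == <[z]> by [].
by rewrite (eq_subG_cyclic (cycle_cyclic g)) ?cycle_subG // -![#|_|]/#[_] ot oz.
Qed.

Lemma order2_mem (gT : finGroupType) (z u : gT) :
  #[z] = 2 -> u \in <[z]> -> u = 1 \/ u = z.
Proof.
by move=> oz /cyclePmin[[|[|i]]]; rewrite oz => // _ ->; [left | right; rewrite expg1].
Qed.

(** Write z as a power of d: the exponent is even, since otherwise z would
    generate <d> and d would have order at most 2. *)
Lemma cycle_sqrt (gT : finGroupType) (d z : gT) :
    2.-elt d -> z \in <[d]> -> z ^+ 2 = 1 ->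
  d ^+ 2 != 1 -> exists2 e, e \in <[d]> & e ^+ 2 = z.
Proof.
move=> d2 /cycleP[m ->] dm2 d2nt; exists (d ^+ m./2); first exact: mem_cycle.
rewrite -expgM muln2 -[in RHS](odd_double_half m).
have [odd_m | //] := boolP (odd m); case/negP: d2nt.
rewrite -order_dvdn -(@Gauss_dvdr _ m); first by rewrite order_dvdn expgM dm2.
by have [n ->] := p_natP d2; rewrite coprimeXl // coprime2n.
Qed.

Lemma maximal_nonmem (gT : finGroupType) (P M : {group gT}) :
  maximal M P -> exists2 g, g \in P & g \notin M.
Proof. by move/maxgroupp/properP=> []. Qed.

Lemma notin_center_commg (gT : finGroupType) (P : {group gT}) x :
  x \in P -> x \notin 'Z(P) -> exists2 g, g \in P & [~ x, g] != 1.
Proof.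
move=> Px Z'x; apply/exists_inP; apply: contraR Z'x => /exists_inPn/= cx.
by apply/centerP; split=> // g Pg; apply/commgP; rewrite -[_ == _]negbK; apply: cx.
Qed.

Lemma mulg_index2 (gT : finGroupType) (P M : {group gT}) x y :
    M \subset P -> #|P : M| = 2 ->
  x \in P -> y \in P -> x \notin M -> y \notin M -> x * y \in M.
Proof.
move=> sMP iM Px Py M'x M'y.
(* The complement of M in P is a single coset of M, so it is also x^-1 M. *)
suffices /setP/(_ y) : x^-1 *: M = P :\: M by rewrite mem_lcoset invgK !inE Py M'y.
apply/eqP; rewrite eqEcard card_lcoset cardsD (setIidPr sMP) -(Lagrange sMP) iM.
rewrite muln2 -addnn addnK leqnn andbT.
apply/subsetP=> w; rewrite mem_lcoset invgK => Mxw.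
have Pw : w \in P by rewrite -(groupMl _ Px) (subsetP sMP).
by rewrite inE Pw andbT; apply: contra M'x => Mw; rewrite -(groupMr _ Mw).
Qed.

Lemma expg_prime_index (gT : finGroupType) (R M : {group gT}) (g : gT) d :
    M <| R -> prime #|R : M| -> g \in R -> g \notin M ->
  (g ^+ d \in M) = (#|R : M| %| d).
Proof.
move=> nsMR pr_p Rg M'g; have nMg := subsetP (normal_norm nsMR) g Rg.
have -> : #|R : M| = #[coset M g].
  apply/esym/(prime_nt_dvdP pr_p); last first.
    by rewrite -card_quotient ?normal_norm // order_dvdG ?mem_quotient.
  by rewrite order_eq1; apply: contra M'g => /eqP/coset_idr; apply.
rewrite order_dvdn -morphX //.
by apply/idP/eqP => [/coset_id // | /coset_idr]; apply; rewrite groupX.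
Qed.

(** A positive even n does not divide 'C(n, 2), as an odd n does; the exponent
    n ^ 2 serves both parities, and is still coprime to whatever n is coprime
    to. *)
Lemma dvdn_bin2_sqr n : n %| 'C(n ^ 2, 2).
Proof.
have [-> // | n_gt0] := posnP n.
have /dvdnP[k Dk] : 2 %| n * (n ^ 2).-1.
  rewrite dvdn2 oddM -subn1 oddB ?expn_gt0 ?n_gt0 // oddX /=.
  by case: (odd n).
by rewrite bin2 {1}expnS expn1 -mulnA Dk mulnA muln2 doubleK dvdn_mulr.
Qed.

(** * Automorphisms fixing a subgroup of prime index pointwise *)

(** Every element of R is m g^i with m in M. The map m g^i |-> m (g c)^i is
    well defined because g^d and (g c)^d agree whenever g^d is in M, that is,
    whenever d is a multiple of the index; it is a morphism because c
    centralises M, so that g and g c act on M in the same way. *)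
Lemma shear_automorphism (gT : finGroupType) (R M : {group gT}) (g c : gT) :
    M <| R -> prime #|R : M| -> g \in R -> g \notin M ->
    c \in 'Z(M) -> (g * c) ^+ #|R : M| = g ^+ #|R : M| ->
  exists f : {morphism R >-> gT},
    [/\ 'injm f, f @* R = R, {in M, f =1 id} & f g = g * c].
Proof.
move=> nsMR pr_p Rg M'g /centerP[Mc cMc] gcp; set p := #|R : M| in pr_p gcp.
have [sMR nMR] := andP nsMR.
have gcd d : g ^+ d \in M -> (g * c) ^+ d = g ^+ d.
  by rewrite (expg_prime_index _ nsMR) // => /dvdnP[k ->]; rewrite mulnC !expgM gcp.
have Rgc : g * c \in R by rewrite groupM // (subsetP sMR).
have M'gc : g * c \notin M by rewrite groupMr.
have gcM d : ((g * c) ^+ d \in M) = (g ^+ d \in M).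
  by rewrite !(expg_prime_index _ nsMR).
pose h m i := m * (g * c) ^+ i.
have h_wd m n i j : m \in M -> n \in M -> m * g ^+ i = n * g ^+ j -> h m i = h n j.
  wlog le_ij : m n i j / i <= j.
    by move=> IH; case: (leqP i j) => [|/ltnW] le_ij Mm Mn ?; [|symmetry]; apply: IH.
  rewrite -{1 2}(subnK le_ij) !expgD mulgA /h => Mm Mn /mulIg Dm; rewrite Dm in Mm *.
  rewrite -(subnK le_ij) addnK expgD mulgA; congr (_ * _ * _).
  by rewrite gcd // -(groupMl _ Mn).
(* A pair (m, i) is picked for each x; the default 1 is only reached outside
   R. *)
pose f x := if [pick q : gT * 'I_#[g] | (q.1 \in M) && (x == q.1 * g ^+ q.2)]
            is Some q then h q.1 q.2 else 1.
have fE m i : m \in M -> f (m * g ^+ i) = h m i.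
  move=> Mm; rewrite /f; case: pickP => [[n j] /= /andP[Mn /eqP Dx] | no_q].
    exact/esym/h_wd.
  have [j lt_j Dg] := cyclePmin (mem_cycle g i).
  by have:= no_q (m, Ordinal lt_j); rewrite /= Mm -Dg eqxx.
have decR x : x \in R -> exists2 m, m \in M & exists i, x = m * g ^+ i.
  have <- : M * <[g]> = R.
    by apply: (mulg_normal_maximal nsMR); rewrite ?p_index_maximal ?cycle_subG.
  by case/mulsgP=> m _ Mm /cycleP[i ->] ->; exists m => //; exists i.
have Jgc d m : m \in M -> m ^ ((g * c) ^+ d) = m ^ (g ^+ d).
  move=> Mm; elim: d => // d IHd; rewrite !expgSr !conjgM IHd.
  have My : (m ^ (g ^+ d)) ^ g \in M.
    by rewrite -conjgM -expgSr memJ_norm // (subsetP nMR) ?groupX.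
  by rewrite [LHS]conjgE -(cMc _ My) mulKg.
have fM : {in R &, {morph f : x y / x * y}}.
  move=> _ _ /decR[m Mm [i ->]] /decR[n Mn [j ->]].
  have Mn' : n ^ (g ^- i) \in M by rewrite memJ_norm ?groupV ?(subsetP nMR) ?groupX.
  have -> : m * g ^+ i * (n * g ^+ j) = m * n ^ (g ^- i) * g ^+ (i + j).
    by rewrite expgD conjgE invgK !mulgA mulgKV.
  rewrite !fE ?(groupM Mm) // /h expgD -{2}(conjgKV (g ^+ i) n) -Jgc // conjgE.
  by rewrite !mulgA mulgK.
have fMid : {in M, f =1 id}.
  by move=> m Mm; rewrite -{1}[m]mulg1 -(expg0 g) fE // /h mulg1.
have fg : f g = g * c by rewrite -{1}[g]mul1g -{1}[g]expg1 fE ?group1 // /h mul1g.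
have injf : 'injm (Morphism fM).
  apply/subsetP=> x /morphpreP[Rx /set1P /= fx1].
  case/decR: Rx fx1 => m Mm [i ->]; rewrite fE // /h => /eqP.
  rewrite -eq_invg_mul => /eqP Dm; have: (g * c) ^+ i \in M by rewrite -Dm groupV.
  by rewrite gcM inE => /gcd Dg; rewrite -Dg -Dm mulgV.
exists (Morphism fM); split=> //.
apply/eqP; rewrite eqEcard card_injm // leqnn andbT.
apply/subsetP=> _ /morphimP[x _ /decR[m Mm [i ->]] ->] /=.
by rewrite fE // groupM ?groupX // (subsetP sMR).
Qed.

(** * Subgroups whose elements normalise every cyclic subgroup *)

Section Norm.

Variables (gT : finGroupType) (R K : {group gT}).
Hypotheses (sKR : K \subset R) (nK : {in K & R, forall x g, x \in 'N(<[g]>)}).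
Implicit Types x g : gT.

Lemma norm_commg_mem x g : x \in K -> g \in R -> [~ x, g] \in <[g]>.
Proof.
move=> Kx Rg; rewrite -groupV invgR commgEl groupM ?groupV ?cycle_id //.
by rewrite memJ_norm ?cycle_id ?nK.
Qed.

Lemma norm_commg_r x g : x \in K -> g \in R -> commute g [~ x, g].
Proof.
by move=> Kx Rg; have /cycleP[i ->] := norm_commg_mem Kx Rg; apply: commuteX.
Qed.

(** The commutator [x, g x] = [x, g]^x belongs to <g x>, and also to <g> because
    x normalises <g>. It commutes with g and g x, so with x, and therefore
    equals [x, g]. *)
Lemma norm_commg_l x g : x \in K -> g \in R -> commute x [~ x, g].
Proof.
move=> Kx Rg; set u := [~ x, g].
have v_g : u ^ x \in <[g]> by rewrite memJ_norm ?nK // norm_commg_mem.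
have v_gx : u ^ x \in <[g * x]>.
  have <- : [~ x, g * x] = u ^ x by rewrite commgMJ commgg mul1g.
  by apply: norm_commg_mem; rewrite // groupM // (subsetP sKR).
have c_v y : u ^ x \in <[y]> -> commute (u ^ x) y.
  by case/cycleP=> i ->; apply: commute_sym; apply: commuteX; apply: commute_refl.
have cvx : commute (u ^ x) x.
  by have:= commuteM (commuteV (c_v g v_g)) (c_v _ v_gx); rewrite mulKg.
have -> : u = u ^ x by apply: (mulIg x); rewrite cvx -conjgC.
exact: commute_sym.
Qed.

Lemma norm_commXg x g n : x \in K -> g \in R -> [~ x ^+ n, g] = [~ x, g] ^+ n.
Proof. by move=> Kx Rg; apply: commXg; apply: norm_commg_l. Qed.

Lemma norm_commgX x g n : x \in K -> g \in R -> [~ x, g ^+ n] = [~ x, g] ^+ n.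
Proof. by move=> Kx Rg; apply: commgX; apply: norm_commg_r. Qed.

(** The order of [x, g] divides both that of x and that of g, as [x, g]^n is
    both [x^n, g] and [x, g^n]. *)
Lemma norm_coprime_commute x g :
  x \in K -> g \in R -> coprime #[x] #[g] -> commute x g.
Proof.
move=> Kx Rg co_xg; apply/commgP; rewrite -order_eq1 -dvdn1 -(eqP co_xg) dvdn_gcd.
by rewrite !order_dvdn -norm_commXg // -norm_commgX // !expg_order comm1g commg1 eqxx.
Qed.

Lemma norm_mulX x g n : x \in K -> g \in R ->
  (g * x) ^+ n = g ^+ n * x ^+ n * [~ x, g] ^+ 'C(n, 2).
Proof.
by move=> Kx Rg; apply: expMg_Rmul; [apply: norm_commg_l | apply: norm_commg_r]. Qed.

(** Put c = [g, y] and n = #[g]. The conjugate g c = g^y has the order of g, and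
    expanding (g c)^(n^2) = 1 leaves c^(n^2) = 1, since n divides the binomial
    exponent of [c, g]. By symmetry the order of c divides the square of #[y]
    as well. *)
Lemma norm_commg_coprime_trivial g y : g \in R -> y \in R -> coprime #[g] #[y] ->
  [~ g, y] \in K -> commute g y.
Proof.
have expc a b : a \in R -> b \in R -> [~ a, b] \in K -> [~ a, b] ^+ (#[a] ^ 2) = 1.
  move=> Ra Rb Kc; have:= norm_mulX (#[a] ^ 2) Kc Ra.
  have /dvdnP[m ->] := dvdn_bin2_sqr #[a].
  rewrite -conjg_mulR -conjXg (mulnC m) -norm_commgX // expnS !(expgM a).
  by rewrite expg_order !expg1n conj1g commg1 mulg1 mul1g.
move=> Rg Ry co_gy Kc; apply/commgP; rewrite -order_eq1 -dvdn1.
have Kc' : [~ y, g] \in K by rewrite -invgR groupV.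
have /eqP <- : coprime (#[g] ^ 2) (#[y] ^ 2) by rewrite coprimeXl ?coprimeXr.
rewrite dvdn_gcd !order_dvdn expc // eqxx -[[~ g, y]]invgR expgVn invg_eq1.
by apply/eqP; apply: expc.
Qed.
End Norm.

(** The normaliser of a Sylow subgroup S contains S and, for each other prime,
    a Sylow subgroup that centralises S. Its order is thus divisible by that of
    R. So all Sylow subgroups are normal, and the Fitting subgroup is R. *)
Lemma coprime_commute_nilpotent (gT : finGroupType) (R : {group gT}) :
  {in R &, forall x y, coprime #[x] #[y] -> commute x y} -> nilpotent R.
Proof.
move=> coR.
have nSylow p (S : {group gT}) : p.-Sylow(R) S -> S <| R.
  move=> sylS; have [sSR pS _] := and3P sylS.
  rewrite /normal sSR; suffices /eqP <- : 'N_R(S) == R :> {set gT} by rewrite subsetIr.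
  rewrite eqEcard subsetIl /= dvdn_leq ?cardG_gt0 //.
  apply/dvdn_partP=> // q _; have [-> | p'q] := eqVneq q p.
    by rewrite -(card_Hall sylS) cardSg // subsetI sSR normG.
  have [Q sylQ] := Sylow_exists q R; have [sQR qQ _] := and3P sylQ.
  rewrite -(card_Hall sylQ) cardSg // subsetI sQR.
  apply: subset_trans (cent_sub S); apply/centsP=> x Qx y Sy.
  apply: coR (subsetP sQR x Qx) (subsetP sSR y Sy) _.
  apply: (p'nat_coprime _ (mem_p_elt pS Sy)).
  by apply: sub_p_elt (mem_p_elt qQ Qx) => r /eqnP->; rewrite inE.
suffices /eqP <- : 'F(R) == R :> {set gT} by exact: Fitting_nil.
rewrite eqEcard Fitting_sub dvdn_leq ?cardG_gt0 //.
apply/dvdn_partP=> // q _; have [Q sylQ] := Sylow_exists q R.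
rewrite -(card_Hall sylQ) cardSg // Fitting_max ?(nSylow q) //.
exact: pgroup_nil (pHall_pgroup sylQ).
Qed.

(** The part of the Dedekind-Baer theorem on Hamiltonian groups used for p = 2:
    x and y generate a quaternion group of order 8. Take x noncentral of least
    order and y not commuting with x. As x^2 is central, c = [x, y] is the
    involution of <x> and of <y>. Let y' be the power of y of the same order as
    x, and n half of this order, so that x^n = y'^n = c. Then (x y')^n is a
    power of c, and it cannot be 1 unless x y' commutes with y, by the choice
    of x. Since its exponent is even unless y' = y and n = 2, this leaves only
    the announced case. *)
Lemma dedekind_quaternion_pair (gT : finGroupType) (K : {group gT}) :
    2.-group K -> {in K & K, forall x g, x \in 'N(<[g]>)} -> ~~ abelian K ->
  exists x y, [/\ x \in K, y \in K, x ^+ 2 = [~ x, y], y ^+ 2 = [~ x, y]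
                & #[[~ x, y]] = 2].
Proof.
move=> pK nK; have sKK := subxx K.
case/subsetPn=> x0 Kx0 C'x0.
have Z'x0 : x0 \notin 'Z(K) by rewrite inE negb_and C'x0 orbT.
pose noncentral x := (x \in K) && (x \notin 'Z(K)).
have nc0 : noncentral x0 by apply/andP.
case: (arg_minnP (fun x => #[x]) nc0) => x /andP[Kx Z'x] min_x.
have small u : u \in K -> #[u] < #[x] -> u \in 'Z(K).
  by move=> Ku; apply: contraTT => Z'u; rewrite -leqNgt min_x // /noncentral Ku.
have [y Ky ncxy] := notin_center_commg Kx Z'x.
have Z'y : y \notin 'Z(K).
  by apply: contra ncxy => /centerP[_ cy]; apply/commgP/commute_sym/cy.
have le_xy : #[x] <= #[y] by apply: min_x; apply/andP.
set c := [~ x, y] in ncxy *.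
have [[|a] ox] := p_natP (mem_p_elt pK Kx).
  by move/eqP: ox ncxy; rewrite order_eq1 /c => /eqP->; rewrite comm1g eqxx.
have [b oy] := p_natP (mem_p_elt pK Ky).
have le_ab : a.+1 <= b by rewrite -(@leq_exp2l 2) // -ox -oy.
have c2 : c ^+ 2 = 1.
  rewrite /c -(norm_commXg sKK nK) //; apply/eqP/commgP.
  have: x ^+ 2 \in 'Z(K).
    apply: small; first exact: groupX.
    by rewrite orderXdiv ox ?dvdn_exp // ltn_Pdiv ?expn_gt0.
  by case/centerP=> _; apply.
have oc : #[c] = 2 by apply: nt_prime_order.
have top_root u i :
  u ^+ (2 ^ i.+1) = 1 -> u ^+ (2 ^ i) != 1 -> c \in <[u]> -> u ^+ (2 ^ i) = c.
  move=> u1 u_nt uc.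
  have := @mem_cycle_prime _ u c (u ^+ (2 ^ i)) 2 isT oc uc (mem_cycle _ _).
  rewrite -expgM -expnSr => /(_ u1); case/cyclePmin=> [[|[|j]]]; rewrite oc // => _.
  by move=> u0; rewrite u0 eqxx in u_nt.
have top_nt u i : #[u] = (2 ^ i.+1)%N -> u ^+ (2 ^ i) != 1.
  by move=> ou; rewrite -order_dvdn ou dvdn_Pexp2l // ltnn.
pose y' := y ^+ (2 ^ (b - a.+1)).
have xa : x ^+ (2 ^ a) = c.
  apply: top_root; [by rewrite -ox expg_order | exact: top_nt |].
  by rewrite /c -invgR groupV (norm_commg_mem nK).
have y'a : y' ^+ (2 ^ a) = c.
  rewrite -expgM -expnD.
  have Db : b = (b - a.+1 + a).+1 by rewrite -addnS subnK.
  apply: top_root; rewrite -?Db -?oy ?expg_order //; last exact: (norm_commg_mem nK).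
  by apply: top_nt; rewrite -Db.
have Ky' : y' \in K by rewrite groupX.
have small_exp : (x * y') ^+ (2 ^ a) != 1.
  apply: contraNneq ncxy => xy'1.
  have: x * y' \in 'Z(K).
    apply: small; first exact: groupM.
    rewrite ox; apply: (@leq_ltn_trans (2 ^ a)); last by rewrite ltn_exp2l.
    by rewrite dvdn_leq ?expn_gt0 // order_dvdn xy'1.
  case/centerP=> _ /(_ y Ky)/commgP; rewrite commMgJ.
  have -> : [~ y', y] = 1 by apply/eqP/commgP/commute_sym/commuteX.
  by rewrite mulg1 conjg_eq1.
have expE : (x * y') ^+ (2 ^ a) = c ^+ (2 ^ (b - a.+1) * 'C(2 ^ a, 2)).
  rewrite (norm_mulX sKK nK) // xa y'a -expg2 c2 mul1g.
  rewrite (norm_commXg sKK nK) // -[[~ y, x]]invgR -/c -expgM; congr (_ ^+ _).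
  by apply/eqP; rewrite eq_invg_mul -expg2 c2.
have odd_e : odd (2 ^ (b - a.+1) * 'C(2 ^ a, 2)).
  apply: contraR small_exp => /negbTE even_e.
  by rewrite expE -(odd_double_half (_ * _)) even_e -mul2n expgM c2 expg1n.
rewrite oddM oddX orbF in odd_e; case/andP: odd_e => b_a odd_bin.
have a1 : a = 1%N.
  case: a odd_bin {le_ab b_a ox xa y'a small_exp expE y' Ky'} => [|[|a]] //.
  by rewrite bin2 {1}expnS -mulnA mul2n doubleK oddM oddX.
exists x, y; split=> //; first by rewrite -/c -xa a1.
by rewrite -/c -y'a /y' (eqP b_a) a1 expg1.
Qed.

(** * Rigid subgroups and nilpotence *)

(** Automorphisms are given as injective morphisms onto R rather than as
    permutations, because they will be obtained by gluing morphisms defined on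
    subgroups. *)
Definition rigid (gT : finGroupType) (R H : {group gT}) : Prop :=
  H \subset R /\
  forall f : {morphism R >-> gT}, 'injm f -> f @* R = R -> f @* H = H ->
  forall L : {group gT}, L \subset R -> f @* L = L.

Lemma rigid_norm (gT : finGroupType) (R H : {group gT}) : rigid R H ->
  {in 'N_R(H) & R, forall x g, x \in 'N(<[g]>)}.
Proof.
case=> sHR rigH x g /setIP[Rx nHx] Rg; have nRx := subsetP (normG R) x Rx.
have:= rigH [morphism of conjgm R x] (injm_conj R x).
rewrite /= morphim_conj setIid (normP nRx) => /(_ erefl).
rewrite morphim_conj (setIidPr sHR) (normP nHx) => /(_ erefl <[g]>%G).
rewrite cycle_subG => /(_ Rg); rewrite morphim_conj (setIidPr _) ?cycle_subG //.
by move/normP.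
Qed.

(** For x in N_R(H), h in H and g in R, the element x normalises the conjugate
    of <h> by g^-1, so x^g normalises <h>. *)
Lemma rigid_norm_normal (gT : finGroupType) (R H : {group gT}) : rigid R H ->
  'N_R(H) <| R.
Proof.
move=> rigH; have nK := rigid_norm rigH; have [sHR _] := rigH.
apply/andP; split; first exact: subsetIl.
apply/subsetP=> g Rg; rewrite inE; apply/subsetP=> _ /imsetP[x Kx ->].
have /setIP[Rx _] := Kx; rewrite inE groupJ //= inE.
apply/subsetP=> _ /imsetP[h Hh ->]; have Rh := subsetP sHR h Hh.
have nxh : x ^ g \in 'N(<[h]>).
  rewrite -[h](conjgKV g) cycleJ normJ memJ_conjg.
  by apply: nK; rewrite ?groupJ ?groupV.
have shH : <[h]> \subset H by rewrite cycle_subG.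
by apply: (subsetP shH); rewrite memJ_norm ?cycle_id.
Qed.

(** If g and y have coprime orders, an element h of H is a product of an element
    of order coprime to #[y] and one of order coprime to #[g]. The first
    commutes with y and its conjugates, the second with g and its conjugates;
    so both commute with [g, y], a product of conjugates of y or of g and their
    inverses. Hence [g, y] is in C_R(H), a subgroup of N_R(H). *)
Lemma rigid_nilpotent (gT : finGroupType) (R H : {group gT}) : rigid R H -> nilpotent R.
Proof.
move=> rigH; have nK := rigid_norm rigH; have [sHR _] := rigH.
have sKR := subsetIl R 'N(H).
have sHK : H \subset 'N_R(H) by rewrite subsetI sHR normG.
apply: coprime_commute_nilpotent => g y Rg Ry co_gy.
apply: (norm_commg_coprime_trivial sKR nK) => //.
rewrite inE groupR //; apply: (subsetP (cent_sub H)).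
apply/centP=> h Hh.
(* The two factors of h are its constituents for the primes dividing #[g] and
   for the other primes. *)
pose pi : nat_pred := \pi(#[g]).
have Kh : h \in 'N_R(H) := subsetP sHK h Hh.
have coJ z a b :
  z \in 'N_R(H) -> a \in R -> b \in R -> coprime #[z] #[a] -> commute z [~ a, b].
  move=> Kz Ra Rb co_za; rewrite commgEl; apply: commuteM.
    by apply: commuteV; apply: (norm_coprime_commute sKR nK).
  by apply: (norm_coprime_commute sKR nK); rewrite ?groupJ // orderJ.
rewrite -(consttC pi h); apply: commuteM; apply: commute_sym.
  rewrite -[[~ g, y]]invgR; apply: commuteV; apply: coJ; rewrite ?groupX //.
  by apply: (pnat_coprime (p_elt_constt pi h)); rewrite -coprime_pi'.
apply: coJ; rewrite ?groupX //.
by apply: (p'nat_coprime (p_elt_constt pi^' h)); apply: pnat_pi.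
Qed.

(** * Rigid subgroups of p-groups, and odd p *)

Section RigidPGroup.

Variables (gT : finGroupType) (p : nat) (P H : {group gT}).
Hypotheses (pP : p.-group P) (ncP : ~~ cyclic P).
Hypotheses (rigH : rigid P H) (prH : H \proper P).
Let pr_p : prime p.
Proof.
have ntP : P :!=: 1 by apply: contraNneq ncP => ->; apply: cyclic1.
by case: (pgroup_pdiv pP ntP).
Qed.

Local Notation K := 'N_P(H)%G.
Let sKP : K \subset P := subsetIl P _.
Let nK : {in K & P, forall x g, x \in 'N(<[g]>)} := rigid_norm rigH.
Let nsKP : K <| P := rigid_norm_normal rigH.
Let sHK : H \subset K.
Proof. by rewrite subsetI normG (proper_sub prH). Qed.

(** The shear fixes H, which lies in M, hence maps <g> to itself. *)
Lemma rigid_shear (M : {group gT}) g c :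
    maximal M P -> H \subset M -> g \in P -> g \notin M -> c \in 'Z(M) ->
  (g * c) ^+ p = g ^+ p -> c \in <[g]>.
Proof.
move=> maxM sHM Pg M'g Zc gcp; have iM := p_maximal_index pP maxM.
have [|||f [injf fP fM fg]] := @shear_automorphism gT P M g c _ _ Pg M'g Zc.
- exact: p_maximal_normal pP maxM.
- by rewrite iM.
- by rewrite iM.
have [_ /(_ f injf fP)] := rigH.
have -> : f @* H = H.
  rewrite morphimEsub ?(proper_sub prH) //.
  rewrite -[RHS]imset_id; apply: eq_in_imset => x Hx; apply: fM; exact: (subsetP sHM).
move=> /(_ erefl <[g]>%G); rewrite cycle_subG => /(_ Pg) /= fgg.
have := mem_morphim f Pg (cycle_id g).
by rewrite fgg fg groupMl ?cycle_id.
Qed.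

Lemma rigid_maximal_exists : exists2 M : {group gT}, maximal M P & H \subset M.
Proof.
have [DH | //] := maximal_exists (proper_sub prH).
by have := properxx P; rewrite -{1}DH prH.
Qed.

(** If t is in M, the shear sending g to g t applies. Otherwise P is the direct
    product of M and <t>, and the shear sending t to t w, where w is central of
    order p in M, would not preserve <t>. *)
Lemma rigid_central_mem (M : {group gT}) t g :
    maximal M P -> H \subset M -> t \in 'Z(P) -> t ^+ p = 1 ->
  g \in P -> g \notin M -> t \in <[g]>.
Proof.
move=> maxM sHM Zt tp Pg M'g; have [Pt cPt] := centerP _ _ Zt.
have sMP := maxgroupp maxM; have {}sMP := proper_sub sMP.
have [Mt | M't] := boolP (t \in M).
  apply: (rigid_shear maxM) => //; last first.
    by rewrite expgMn ?tp ?mulg1 //; apply/commute_sym/cPt.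
  by apply/centerP; split=> // x /(subsetP sMP)/cPt.
have ntM : 'Z(M) != 1.
  rewrite (center_nil_eq1 (pgroup_nil (pgroupS sMP pP))).
  apply: contra ncP => /eqP M1; apply: prime_cyclic.
  by rewrite -(indexg1 P) -M1 (p_maximal_index pP).
have [_ p_dv _] := pgroup_pdiv (pgroupS (subset_trans (center_sub M) sMP) pP) ntM.
have [w Zw ow] := Cauchy pr_p p_dv.
have tw : w \in <[t]>.
  apply: (rigid_shear maxM) => //; rewrite expgMn -?ow ?expg_order ?mulg1 //.
  by apply: cPt; rewrite (subsetP sMP) // (subsetP (center_sub M)).
case/negP: M't; have Mw := subsetP (center_sub M) w Zw.
have: t \in <[w]> by apply: (mem_cycle_prime pr_p ow tw); rewrite ?cycle_id.
by apply/subsetP; rewrite cycle_subG.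
Qed.

Variable z : gT.
Hypotheses (Zz : z \in 'Z(P)) (oz : #[z] = p).

Lemma rigid_central_uniq t : t \in 'Z(P) -> t ^+ p = 1 -> t \in <[z]>.
Proof.
move=> Zt tp; have [M maxM sHM] := rigid_maximal_exists.
have [g Pg M'g] := maximal_nonmem maxM.
apply: (@mem_cycle_prime _ g _ _ p) => //; apply: (rigid_central_mem maxM) => //.
by rewrite -oz expg_order.
Qed.

(** For g outside a maximal M containing H, both z and [x, g] lie in <g> and
    have p-th power 1. The remaining elements of P are quotients of two
    elements outside M. *)
Lemma rigid_commg x g : x \in K -> x ^+ p \in 'Z(P) -> g \in P -> [~ x, g] \in <[z]>.
Proof.
move=> Kx Zxp; have [M maxM sHM] := rigid_maximal_exists.
have outM a : a \in P -> a \notin M -> [~ x, a] \in <[z]>.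
  move=> Pa M'a; apply: (@mem_cycle_prime _ a _ _ p) => //.
  - by apply: (rigid_central_mem maxM); rewrite // -oz expg_order.
  - exact: (norm_commg_mem nK).
  rewrite -(norm_commXg sKP nK) //; apply/eqP/commgP.
  by case/centerP: Zxp => _; apply.
move=> Pg; have [Mg | /outM] := boolP (g \in M); last by apply.
have [a Pa M'a] := maximal_nonmem maxM.
have M'ga : g * a \notin M by rewrite groupMl.
have := outM _ (groupM Pg Pa) M'ga.
rewrite commgMJ (groupMl _ (outM a Pa M'a)).
have nza : a \in 'N(<[z]>).
  rewrite (subsetP (cent_sub _)) // cent_cycle.
  by apply/cent1P/commute_sym; case/centerP: Zz => _; apply.
by rewrite memJ_norm.
Qed.

(** The conjugates of x lie in the coset of <z> at x, so there are at most p of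
    them. *)
Lemma rigid_cent_maximal x : x \in K -> x ^+ p \in 'Z(P) -> x \notin 'Z(P) ->
  maximal 'C_P[x] P.
Proof.
move=> Kx Zxp Z'x; apply: p_index_maximal; first exact: subsetIl.
have le_p : #|P : 'C_P[x]| <= p.
  rewrite index_cent1 -oz -[#[z]](card_lcoset _ x); apply: subset_leq_card.
  apply/subsetP=> _ /imsetP[g Pg ->].
  by rewrite mem_lcoset -commgEl rigid_commg.
have [[|[|n]] iPC] := p_natP (pnat_dvd (dvdn_indexg P 'C_P[x]) pP);
  rewrite iPC ?expn1 // in le_p *.
  case/negP: Z'x; rewrite inE (subsetP sKP) //= -sub_cent1.
  by rewrite -(index1g (subsetIl P 'C[x]) iPC) subsetIr.
by rewrite -{2}[p]expn1 leq_exp2l ?prime_gt1 in le_p.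
Qed.

(** A nontrivial [k, l] would generate <k> and lie in <l>. *)
Lemma norm_prime_central k l : k \in K -> k ^+ p = 1 -> l \in K -> commute k l.
Proof.
move=> Kk kp Kl; have [Pk Pl] := (subsetP sKP k Kk, subsetP sKP l Kl).
apply/commgP; apply: contraT => nt_c; set c := [~ k, l] in nt_c.
have kc : c \in <[k]> by rewrite /c -invgR groupV (norm_commg_mem nK).
have lc : c \in <[l]> by apply: (norm_commg_mem nK).
have cp : c ^+ p = 1 by rewrite /c -(norm_commXg sKP nK) // kp comm1g.
have k_c : k \in <[c]>.
  apply: (@mem_cycle_prime _ k _ _ p); rewrite ?cycle_id //.
  exact: nt_prime_order.
have /cycleP[i Dk] : k \in <[l]> by apply: subsetP k_c; rewrite cycle_subG.
case/negP: nt_c; apply/commgP; rewrite Dk; apply: commute_sym; apply: commuteX.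
exact: commute_refl.
Qed.

(** If K is cyclic, H is characteristic in K, so normal in P, and P = K. *)
Lemma rigid_norm_cyclic : ~~ cyclic K.
Proof.
apply: contra ncP => cycK; suffices <- : K :=: P by [].
apply/setIidPl; apply: normal_norm.
by apply: char_normal_trans nsKP; rewrite sub_cyclic_char.
Qed.

Lemma rigid_cent_max k : k \in K -> k ^+ p = 1 -> k \notin <[z]> ->
  [/\ maximal 'C_P[k] P, H \subset 'C_P[k] & k \in 'Z('C_P[k])].
Proof.
move=> Kk kp zk.
have Z'k : k \notin 'Z(P) by apply: contra zk => /rigid_central_uniq; apply.
split; first by rewrite rigid_cent_maximal ?kp ?group1.
  rewrite subsetI (proper_sub prH); apply/subsetP=> h Hh; apply/cent1P.
  exact/commute_sym/(norm_prime_central Kk kp)/(subsetP sHK).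
apply/centerP; split=> [|x /setIP[_ /cent1P]//].
by rewrite inE (subsetP sKP) //=; apply/cent1P.
Qed.

(** Otherwise (g k)^p = g^p for every g not commuting with k, because p divides
    'C(p, 2). The shear by k over C_P(k) makes k a power of g. *)
Lemma rigid_norm_prime_odd k : odd p -> k \in K -> k ^+ p = 1 -> k \in <[z]>.
Proof.
move=> odd_p Kk kp; apply: contraT => zk.
have [maxM sHM ZMk] := rigid_cent_max Kk kp zk.
have [g Pg M'g] := maximal_nonmem maxM.
have /cycleP[i Dk] : k \in <[g]>.
  apply: (rigid_shear maxM) => //.
  rewrite (norm_mulX sKP nK) // kp mulg1.
  have /dvdnP[m ->] : p %| 'C(p, 2) by rewrite prime_dvd_bin ?odd_prime_gt2.
  by rewrite mulnC expgM -(norm_commXg sKP nK) // kp comm1g expg1n mulg1.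
case/negP: M'g; rewrite inE Pg; apply/cent1P; rewrite Dk.
by apply: commuteX; apply: commute_refl.
Qed.

Lemma norm_rank1 : {in K, forall k, k ^+ p = 1 -> k \in <[z]>} -> 'r_p(K) <= 1.
Proof.
move=> uniqK; rewrite -p_rank_Ohm1; apply: leq_trans (p_rank_le_logn p _) _.
have sO : 'Ohm_1(K) \subset <[z]>.
  rewrite (OhmE _ (pgroupS sKP pP)) gen_subG; apply/subsetP=> k.
  by case/setIP=> Kk; rewrite inE expn1 => /eqP; apply: uniqK.
have lz : logn p #[z] = 1%N by rewrite oz logn_prime ?eqxx.
by rewrite -[leqRHS]lz dvdn_leq_log ?order_gt0 ?cardSg.
Qed.

Lemma rigid_not_odd : ~~ odd p.
Proof.
apply: contra rigid_norm_cyclic => odd_p.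
have pK := pgroupS sKP pP.
rewrite (odd_pgroup_rank1_cyclic pK) ?(odd_pgroup_odd _ pK) //.
by apply: norm_rank1 => k Kk kp; apply: rigid_norm_prime_odd.
Qed.

End RigidPGroup.

(** * Rigid subgroups of 2-groups *)

Section RigidTwoGroup.

Variables (gT : finGroupType) (P H : {group gT}).
Hypotheses (pP : 2.-group P) (ncP : ~~ cyclic P).
Hypotheses (rigH : rigid P H) (prH : H \proper P).
Variable z : gT.
Hypotheses (Zz : z \in 'Z(P)) (oz : #[z] = 2).

Local Notation K := 'N_P(H)%G.
Let sKP : K \subset P := subsetIl P _.
Let nK : {in K & P, forall x g, x \in 'N(<[g]>)} := rigid_norm rigH.
Let nsKP : K <| P := rigid_norm_normal rigH.
Let sHP : H \subset P := proper_sub prH.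
Let sHK : H \subset K.
Proof. by rewrite subsetI normG sHP. Qed.
Let zz : z ^+ 2 = 1. Proof. by rewrite -oz expg_order. Qed.
Let nz1 : z != 1. Proof. by rewrite -order_gt1 oz. Qed.
Let KP x : x \in K -> x \in P. Proof. exact: (subsetP sKP). Qed.
Let cz x : x \in P -> commute z x. Proof. by case/centerP: Zz => _; apply. Qed.

Let commK x g : x \in K -> g \in P -> [~ x, g] \in K.
Proof.
move=> Kx Pg; rewrite commgEl groupM ?groupV // memJ_norm //.
exact: (subsetP (normal_norm nsKP)).
Qed.

Let comm_z x g :
  x \in K -> x ^+ 2 \in 'Z(P) -> g \in P -> [~ x, g] != 1 -> [~ x, g] = z.
Proof.
move=> Kx Zx2 Pg nt; have := rigid_commg pP ncP rigH prH Zz oz Kx Zx2 Pg.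
by case/(order2_mem oz) => // u1; rewrite u1 eqxx in nt.
Qed.

Let root_z g : g \in P -> z \in <[g]> -> g ^+ 2 = 1 -> g = z.
Proof.
move=> Pg gz g2; have := @mem_cycle_prime _ g z g 2 isT oz gz (cycle_id g) g2.
case/(order2_mem oz) => // g1; case/negP: nz1; move: gz.
by rewrite g1 cycle1 inE.
Qed.

Section SecondInvolution.

Variable k : gT.
Hypotheses (abK : abelian K) (Kk : k \in K) (k2 : k ^+ 2 = 1) (zk : k \notin <[z]>).

Let cK x y : x \in K -> y \in K -> commute x y.
Proof. by move=> Kx Ky; apply: (centsP abK). Qed.

Let not_cent_k : exists2 g, g \in P & [~ k, g] = z.
Proof.
have [maxM _ _] := rigid_cent_max pP ncP rigH prH Zz oz Kk k2 zk.
have [g Pg M'g] := maximal_nonmem maxM; exists g => //.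
apply: comm_z; rewrite ?k2 ?group1 //; apply: contra M'g => /commgP ckg.
by rewrite inE Pg; apply/cent1P/commute_sym.
Qed.

(** If w is central, the shear by w k over C_P(k) applies, since
    (g w k)^2 = g^2 w^2 [k, g] = g^2 for g not commuting with k. If it is not,
    the shear by w over C_P(w) applies in the same way. Either would make the
    shearing element commute with g. *)
Lemma norm_no_sqrt w : w \in K -> w ^+ 2 <> z.
Proof.
move=> Kw w2; have [Zw | Z'w] := boolP (w \in 'Z(P)).
  have [maxM sHM ZMk] := rigid_cent_max pP ncP rigH prH Zz oz Kk k2 zk.
  have [g Pg kg] := not_cent_k.
  have cwk : [~ w * k, g] = z.
    rewrite commMgJ kg (_ : [~ w, g] = 1) ?conj1g ?mul1g //.
    by apply/eqP/commgP; case/centerP: Zw => _; apply.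
  have Kwk : w * k \in K by rewrite groupM.
  suffices : w * k \in <[g]>.
    case/cycleP=> i Dwk; move/eqP: nz1; apply; rewrite -cwk Dwk.
    by apply/eqP/commgP/commute_sym/commuteX.
  apply: (rigid_shear pP ncP rigH prH maxM) => //.
  - apply/negP => /setIP[_ /cent1P ckg]; move/eqP: nz1; apply; rewrite -kg.
    by apply/eqP/commgP/commute_sym.
  - rewrite groupM //; apply/centerP; split=> [|x /setIP[Px _]].
      rewrite inE KP //; apply/cent1P; exact: cK.
    by case/centerP: Zw => _; apply.
  rewrite (norm_mulX sKP nK) // cwk bin2 expgMn; last exact: cK.
  by rewrite w2 k2 mulg1 -mulgA -expg2 zz mulg1.
have Zw2 : w ^+ 2 \in 'Z(P) by rewrite w2.
have maxM := rigid_cent_maximal pP ncP rigH prH Zz oz Kw Zw2 Z'w.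
have [g Pg M'g] := maximal_nonmem maxM.
have wg : [~ w, g] = z.
  apply: comm_z => //; apply: contra M'g => /commgP ?.
  by rewrite inE Pg; apply/cent1P/commute_sym.
suffices : w \in <[g]>.
  case/cycleP=> i Dw; move/eqP: nz1; apply; rewrite -wg Dw.
  by apply/eqP/commgP/commute_sym/commuteX.
apply: (rigid_shear pP ncP rigH prH maxM) => //.
- rewrite subsetI sHP; apply/subsetP=> h Hh; apply/cent1P.
  by apply: cK => //; apply: (subsetP sHK).
- apply/centerP; split=> [|x /setIP[_ /cent1P]//].
  by rewrite inE KP //; apply/cent1P.
by rewrite (norm_mulX sKP nK) // wg w2 -mulgA -expg2 zz mulg1.
Qed.

(** If x^2 is a noncentral involution and g does not commute with it, [x, g] is a
    square root of z in K, as its square is [x^2, g]. A central x^2 other than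
    1 is z. Both are excluded by [norm_no_sqrt]. *)
Lemma norm_expn2 x : x \in K -> x ^+ 4 = 1 -> x ^+ 2 = 1.
Proof.
move=> Kx x4; have Kx2 : x ^+ 2 \in K by rewrite groupX.
have x22 : (x ^+ 2) ^+ 2 = 1 by rewrite -expgM.
have [Zx2 | Z'x2] := boolP (x ^+ 2 \in 'Z(P)).
  have := rigid_central_uniq pP ncP rigH prH Zz oz Zx2 x22.
  by case/(order2_mem oz) => // /norm_no_sqrt; case.
have [g Pg cxg] := notin_center_commg (KP Kx2) Z'x2.
have /norm_no_sqrt[] : [~ x, g] \in K by apply: commK.
rewrite -(norm_commXg sKP nK) //; apply: comm_z => //.
by rewrite x22 group1.
Qed.

Lemma norm_expn2_all x : x \in K -> x ^+ 2 = 1.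
Proof.
move=> Kx; have [n on] := p_natP (mem_p_elt pP (KP Kx)).
case: n on => [|[|n]] on.
- by move/eqP: on; rewrite order_eq1 => /eqP->; rewrite expg1n.
- by apply/eqP; rewrite -order_dvdn on.
have: (x ^+ (2 ^ n)) ^+ 2 = 1.
  by apply: norm_expn2; rewrite ?groupX // -expgM -(expnD 2 n 2) addn2 -on expg_order.
move/eqP; rewrite -expgM -order_dvdn on -expnSr => /(dvdn_leq (expn_gt0 2 _)).
by rewrite leq_exp2l // ltnn.
Qed.

(** For y not commuting with k, z is a power of y, so y^2 is not 1. Let g be
    such an element. Then g^2 centralises H, since [h, g^2] = [h^2, g], so it
    lies in K and its square is 1. Hence g^2 = z and (g k)^2 = g^2 z = 1,
    although g k does not commute with k either. *)
Lemma second_involution_absurd : False.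
Proof.
have [g Pg kg] := not_cent_k.
have [maxM sHM ZMk] := rigid_cent_max pP ncP rigH prH Zz oz Kk k2 zk.
have out y : y \in P -> [~ k, y] = z -> z \in <[y]>.
  move=> Py ky; apply: (rigid_central_mem pP ncP rigH prH maxM) => //.
  apply/negP => /setIP[_ /cent1P cky]; move/eqP: nz1; apply; rewrite -ky.
  by apply/eqP/commgP/commute_sym.
have no_z y : y \in P -> [~ k, y] = z -> y ^+ 2 <> 1.
  move=> Py ky y2; move/eqP: nz1; apply; rewrite -ky.
  rewrite (root_z Py (out y Py ky) y2); apply/eqP/commgP/commute_sym/cz; exact: KP.
have Kg2 : g ^+ 2 \in K.
  rewrite inE groupX //; apply: (subsetP (cent_sub H)); apply/centP=> h Hh.
  have Kh := subsetP sHK h Hh.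
  apply/commute_sym/commgP; rewrite (norm_commgX nK) // -(norm_commXg sKP nK) //.
  by rewrite norm_expn2_all // comm1g.
have g2z : g ^+ 2 = z.
  have : g ^+ 2 \in <[z]>.
    apply: (@mem_cycle_prime _ g _ _ 2) => //; first exact: out.
      by rewrite mem_cycle.
    exact: norm_expn2_all.
  by case/(order2_mem oz) => // /(no_z g Pg kg).
apply: (no_z (g * k)); first by rewrite groupM // KP.
  by rewrite commgMJ commgg mul1g kg; apply/conjg_fixP/commgP/cz; apply: KP.
by rewrite (norm_mulX sKP nK) // g2z k2 kg mulg1 -expg2 zz.
Qed.

End SecondInvolution.

Section QuaternionPair.

Variable M : {group gT}.
Hypotheses (maxM : maximal M P) (sHM : H \subset M).

Definition quaternion_pair u v :=
  [/\ u \in K, v \in K, u ^+ 2 = z, v ^+ 2 = z & [~ u, v] = z].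

Let sMP : M \subset P := proper_sub (maxgroupp maxM).
Let zV : z^-1 = z. Proof. by apply/eqP; rewrite eq_invg_mul -expg2 zz. Qed.
Let Jz x : x \in P -> z ^ x = z.
Proof. by move=> Px; apply/conjg_fixP/commgP/cz. Qed.
Let JzX x n : x \in P -> (z ^+ n) ^ x = z ^+ n.
Proof. by move=> Px; rewrite conjXg Jz. Qed.
Let zXX n : z ^+ n * z ^+ n = 1.
Proof. by rewrite -expgMn // -expg2 zz expg1n. Qed.

Lemma quaternion_pair_sym u v : quaternion_pair u v -> quaternion_pair v u.
Proof. by case=> Ku Kv u2 v2 uv; split=> //; rewrite -[[~ v, u]]invgR uv. Qed.

Lemma quaternion_pair_mul u v : quaternion_pair u v -> quaternion_pair u (u * v).
Proof.
move=> Quv; have [Ku Kv u2 v2 uv] := Quv; have [_ _ _ _ vu] := quaternion_pair_sym Quv.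
split=> //; first exact: groupM.
  by rewrite (norm_mulX sKP nK) ?KP // u2 v2 vu expg1 -expg2 zz mul1g.
by rewrite commgMJ uv commgg conj1g mulg1.
Qed.

(** For d outside M, z is a power of d and so has a square root e in <d>. Then
    (v e)^2 = 1, although z = [u, v e] is in <v e>. *)
Lemma quaternion_pair_cent u v d : quaternion_pair u v -> d \in P ->
  commute u d -> commute v d -> d \in M.
Proof.
case=> Ku Kv u2 v2 uv Pd cud cvd; apply: contraT => M'd.
have zd : z \in <[d]> by apply: (rigid_central_mem pP ncP rigH prH maxM); rewrite ?zz.
have zM : z \in M.
  rewrite -u2; have [Mu | M'u] := boolP (u \in M); first exact: groupX.
  have iM := p_maximal_index pP maxM.
  by rewrite (expg_prime_index _ (p_maximal_normal pP maxM)) ?iM ?KP.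
have [e /cycleP[i De] e2] : exists2 e, e \in <[d]> & e ^+ 2 = z.
  have d2 : d ^+ 2 != 1 by apply: contraNneq M'd => d2; rewrite (root_z Pd zd d2).
  exact: cycle_sqrt (mem_p_elt pP Pd) zd zz d2.
have cue : commute u e by rewrite De; apply: commuteX.
have cve : commute v e by rewrite De; apply: commuteX.
have Pe : e \in P by rewrite De groupX.
have Pev : v * e \in P by rewrite groupM // KP.
have uve : [~ u, v * e] = z.
  by rewrite commgMJ uv Jz // (_ : [~ u, e] = 1) ?mul1g //; apply/eqP/commgP.
have zve : z \in <[v * e]> by rewrite -uve (norm_commg_mem nK).
have ve2 : (v * e) ^+ 2 = 1 by rewrite expgMn // v2 e2 -expg2 zz.
case/eqP: nz1; rewrite -uve (root_z Pev zve ve2); apply/eqP/commgP/commute_sym/cz.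
exact: KP.
Qed.

(** Conjugation by r multiplies each of u and v by a power of z, as does
    conjugation by a suitable element of <u, v>. *)
Lemma quaternion_pair_complement u v r : quaternion_pair u v -> r \in P ->
  exists i j, commute u (r * u ^+ i * v ^+ j) /\ commute v (r * u ^+ i * v ^+ j).
Proof.
move=> Quv Pr; have [Ku Kv u2 v2 uv] := Quv.
have [_ _ _ _ vu] := quaternion_pair_sym Quv.
have [Pu Pv] := (KP Ku, KP Kv).
have comm_cycle w : w \in K -> w ^+ 2 = z -> [~ w, r] \in <[z]>.
  by move=> Kw w2; apply: (rigid_commg pP ncP rigH prH Zz oz); rewrite ?w2.
have /cycleP[i vr] := comm_cycle v Kv v2; have /cycleP[j ur] := comm_cycle u Ku u2.
have cXX (w : gT) n : [~ w, w ^+ n] = 1 by apply/eqP/commgP/commuteX.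
exists i, j; split; apply/commgP/eqP; rewrite commgMJ.
  rewrite (commgMJ u r) cXX mul1g ur JzX ?groupX // (norm_commgX nK) // uv.
  by rewrite JzX ?groupX ?zXX.
by rewrite (commgMJ v r) cXX mul1g vr JzX ?groupX // (norm_commgX nK) // vu zXX conj1g.
Qed.

(** If v were in M, it would be central in M, because M is generated by v, z
    and elements commuting with u and v. As (u v)^2 = z = u^2, the shear
    sending u to u v would make v a power of u. *)
Lemma quaternion_pair_notin u v :
  quaternion_pair u v -> u \notin M -> v \notin M.
Proof.
move=> Quv M'u; apply/negP=> Mv; have [Ku Kv u2 v2 uv] := Quv.
have [_ _ _ _ vu] := quaternion_pair_sym Quv.
have [Pu Pv] := (KP Ku, KP Kv).
suffices : v \in <[u]>.
  case/cycleP=> n Dv; move/eqP: nz1; apply; rewrite -uv Dv.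
  by apply/eqP/commgP/commuteX.
apply: (rigid_shear pP ncP rigH prH maxM) => //; last first.
  by rewrite (norm_mulX sKP nK) // u2 v2 vu -mulgA -expg2 zz mulg1.
apply/centerP; split=> // m Mm; have Pm := subsetP sMP m Mm.
have [i [j [cu cv]]] := quaternion_pair_complement Quv Pm.
have Pd : m * u ^+ i * v ^+ j \in P by rewrite !groupM ?groupX.
have := quaternion_pair_cent Quv Pd cu cv; rewrite groupMr ?groupX // groupMl //.
have iM := p_maximal_index pP maxM.
(* The exponent i of u is even, so u ^+ i is a power of z. *)
rewrite (expg_prime_index _ (p_maximal_normal pP maxM)) ?iM // => /dvdnP[n Di].
have : commute v (m * u ^+ i * v ^+ j * v ^- j * u ^- i).
  have cvv : commute v (v ^- j) by apply/commuteV/commuteX.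
  have cvu : commute v (u ^- i).
    apply/commuteV; rewrite Di mulnC expgM u2; apply/commuteX/commute_sym/cz/Pv.
  by do 2?apply: commuteM.
by rewrite mulgK mulgK.
Qed.

End QuaternionPair.

(** Let x, y generate a quaternion subgroup of K and c = [x, y]. If [c, g] = z
    for some g, then [x, g], [y, g] and [x y, g], whose squares are all
    [c, g], are elements of <g> with square z; but the third is the product of
    a conjugate of the first and the second, so its square is z z = 1. Hence
    c is central, and c = z. Now let M be maximal containing H. Not both x and
    y are in M, since M contains the centraliser of x and y; and one of the
    pairs (x, y), (y, x), (x, x y) has its first member outside M and its
    second inside. *)
Lemma norm_abelian : abelian K.
Proof.
apply: contraT => nabK; have pK := pgroupS sKP pP.
have nKK : {in K & K, forall x g, x \in 'N(<[g]>)} by move=> x g Kx /KP; apply: nK.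
have [x [y [Kx Ky x2 y2]]] := dedekind_quaternion_pair pK nKK nabK.
set c := [~ x, y] in x2 y2 * => oc.
have Kc : c \in K by rewrite groupR.
have c2 : c ^+ 2 = 1 by rewrite -oc expg_order.
have Zc : c \in 'Z(P).
  apply: contraT => Z'c.
  have [g Pg ncg] := notin_center_commg (KP Kc) Z'c.
  have cg : [~ c, g] = z by apply: comm_z; rewrite // c2 group1.
  have sq w : w \in K -> w ^+ 2 = c -> [~ w, g] ^+ 2 = z.
    by move=> Kw w2; rewrite -(norm_commXg sKP nK) // w2.
  have xy2 : (x * y) ^+ 2 = c.
    by rewrite (norm_mulX sKP nK) ?KP // x2 y2 -[[~ y, x]]invgR -/c expg1 mulgK.
  case/eqP: nz1; rewrite -(sq _ (groupM Kx Ky) xy2) commMgJ.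
  have gx : [~ x, g] ^ y \in <[g]> by rewrite memJ_norm ?nK // (norm_commg_mem nK).
  have gy : [~ y, g] \in <[g]> by apply: (norm_commg_mem nK).
  rewrite expgMn; last by apply: (centsP (cycle_abelian g)).
  by rewrite -conjXg !sq // (conjg_fixP _) -?expg2 ?zz //; apply/commgP/cz/KP.
have Dc : c = z.
  have := rigid_central_uniq pP ncP rigH prH Zz oz Zc c2.
  by case/(order2_mem oz) => // c1; rewrite c1 order1 in oc.
have Qxy : quaternion_pair x y by split; rewrite -?Dc.
have [M maxM sHM] := rigid_maximal_exists prH.
have sMP : M \subset P := proper_sub (maxgroupp maxM).
have [Mx | M'x] := boolP (x \in M); have [My | M'y] := boolP (y \in M).
- have [r Pr M'r] := maximal_nonmem maxM.
  have [i [j [cu cv]]] := quaternion_pair_complement Qxy Pr.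
  have Pd : r * x ^+ i * y ^+ j \in P by rewrite !groupM ?groupX // KP.
  have := quaternion_pair_cent maxM sHM Qxy Pd cu cv.
  by rewrite !groupMr ?groupX // (negPf M'r).
- by have:= quaternion_pair_notin maxM sHM (quaternion_pair_sym Qxy) M'y; rewrite Mx.
- by have:= quaternion_pair_notin maxM sHM Qxy M'x; rewrite My.
case/negP: (quaternion_pair_notin maxM sHM (quaternion_pair_mul Qxy) M'x).
by apply: mulg_index2 sMP (p_maximal_index pP maxM) _ _ _ _; rewrite ?KP.
Qed.

Lemma rigid_2group_absurd : False.
Proof.
have uniqK : {in K, forall k, k ^+ 2 = 1 -> k \in <[z]>}.
  move=> k Kk k2; apply: contraT => zk.
  by case: (second_involution_absurd norm_abelian Kk k2 zk).
case/negP: (rigid_norm_cyclic ncP rigH prH).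
rewrite abelian_rank1_cyclic ?norm_abelian // (rank_pgroup (pgroupS sKP pP)).
exact: (norm_rank1 pP ncP oz).
Qed.

End RigidTwoGroup.

(** * Reduction to p-groups, and the theorem *)

(** Every automorphism stabilises R, so rigidity of R says that all
    automorphisms fix all subgroups. This is how a rigid subgroup can be chosen
    proper. *)
Lemma rigid_self (gT : finGroupType) (R : {group gT}) : rigid R R -> rigid R 1%G.
Proof.
by case=> sRR rigR; split=> [|f injf fR _]; [apply: sub1G | apply: rigR].
Qed.

Lemma rigid_pgroup_cyclic (gT : finGroupType) (p : nat) (P H : {group gT}) :
  p.-group P -> rigid P H -> cyclic P.
Proof.
move=> pP; wlog prH : H / H \proper P => [IH rigH | rigH].
  have [sHP _] := rigH; have [prH | sPH] := boolP (H \proper P); first exact: IH rigH.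
  have DH : H = P by apply/eqP; rewrite -val_eqE /= eqEproper sHP sPH.
  have [/eqP-> | ntP] := boolP (P :==: 1); first exact: cyclic1.
  apply: (IH 1%G); first by rewrite proper1G.
  by apply: rigid_self; rewrite -{2}DH.
apply: contraT => ncP.
have ntP : P :!=: 1 by apply: contraNneq ncP => ->; apply: cyclic1.
have ntZ : 'Z(P) != 1 by rewrite (center_nil_eq1 (pgroup_nil pP)).
have [pr_p p_dv _] := pgroup_pdiv (pgroupS (center_sub P) pP) ntZ.
have [z Zz oz] := Cauchy pr_p p_dv.
have [p2 | odd_p] := even_prime pr_p; last first.
  by case/negP: (rigid_not_odd pP ncP rigH prH Zz oz).
by rewrite p2 in pP oz; case: (rigid_2group_absurd pP ncP rigH prH Zz oz).
Qed.

(** An automorphism of the p-part of R extends by the identity on the p'-part,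
    and H is the product of its intersections with both parts. *)
Lemma rigid_pcore (gT : finGroupType) (p : nat) (R H : {group gT}) :
  nilpotent R -> rigid R H -> rigid 'O_p(R) 'O_p(H).
Proof.
move=> nilR [sHR rigH]; have nilH := nilpotentS sHR nilR.
have sO pi : 'O_pi(H) \subset 'O_pi(R).
  rewrite (sub_Hall_pcore (nilpotent_pcore_Hall pi nilR)) ?pcore_pgroup //.
  exact: subset_trans (pcore_sub _ _) sHR.
split=> [|f injf fP fQ L sLP]; first exact: sO.
have defR := nilpotent_pcoreC p nilR; have defH := nilpotent_pcoreC p nilH.
have [_ _ cPQ tiPQ] := dprodP defR.
have cfQ : idm 'O_p^'(R) @* 'O_p^'(R) \subset 'C(f @* 'O_p(R)).
  by rewrite morphim_idm // fP.
pose F := [morphism of dprodm defR cfQ].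
rewrite -(morphim_dprodml defR cfQ sLP); apply: (rigH F).
- by rewrite injm_dprodm injf injm_idm morphim_idm // fP tiPQ eqxx.
- by rewrite /= im_dprodm fP morphim_idm // (dprodW defR).
- by rewrite /= -{1}(dprodW defH) morphim_dprodm // fQ morphim_idm // (dprodW defH).
exact: subset_trans sLP (pcore_sub _ _).
Qed.

Lemma rigid_cyclic (gT : finGroupType) (R H : {group gT}) : rigid R H -> cyclic R.
Proof.
move=> rigH; have nilR := rigid_nilpotent rigH.
apply: nil_Zgroup_cyclic nilR; apply/forall_inP=> S /SylowP[p _ sylS].
rewrite (nilpotent_Hall_pcore (rigid_nilpotent rigH) sylS).
apply: (@rigid_pgroup_cyclic _ p _ 'O_p(H)%G (pcore_pgroup _ _)).
exact: rigid_pcore (rigid_nilpotent rigH) rigH.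
Qed.

Lemma actperm_SubRE (gT : finGroupType) (R L : {group gT}) a :
    a \in Aut R -> L \subset R ->
  actperm <[Aut_acts_SubR R]> a L = a @: L.
Proof.
move=> Aa sLR; rewrite actpermE actbyE //.
by apply: imset_f; rewrite inE.
Qed.

Lemma AR_cyclic (gT : finGroupType) (R : {group gT}) : cyclic R -> AR R = 1%G.
Proof.
move=> cycR; apply/trivGP/subsetP=> _ /morphimP[a _ Aa ->]; apply/set1P/permP=> L.
rewrite perm1; have [/imsetP[G] | SL] := boolP (L \in SubR R); last first.
  by rewrite actpermE /= /actby (negPf SL).
rewrite inE => sGR ->; rewrite actperm_SubRE //.
have /andP[_ /forall_inP/(_ a Aa) saG] : G \char R by rewrite sub_cyclic_char.
by apply/eqP; rewrite eqEcard saG (card_imset _ (@perm_inj _ a)) /=.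
Qed.

Theorem corollary1p2 (gT : finGroupType) (R : {group gT}) :
  (exists O : {set {set gT}},
      O \in [set orbit 'P^* (Aut R) H | H in SubR R] /\
      regular_on 'P (AR R) O)
  <-> cyclic R.
Proof.
split=> [[O [/imsetP[_ /imsetP[H sHR ->] ->] [_ regO]]] | cycR].
  rewrite inE in sHR; apply: (@rigid_cyclic _ R H); split=> // f injf fR fH L sLR.
  have Aa := Aut_aut injf fR; set a := aut injf fR in Aa.
  have aE (G : {group gT}) : G \subset R -> a @: G = f @* G.
    move=> sGR; rewrite morphimEsub //; apply: eq_in_imset => x Gx.
    by rewrite autE // (subsetP sGR).
  have: actperm <[Aut_acts_SubR R]> a \in 'C_(AR R)[gval H | 'P].
    rewrite inE mem_morphim //=; apply/astab1P.
    by rewrite /= apermE actperm_SubRE // aE.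
  rewrite (regO _ (orbit_refl _ _ _)) => /set1P a1.
  by rewrite -aE // -(actperm_SubRE Aa sLR) a1 perm1.
have AR1 := AR_cyclic cycR; exists [set gval R].
have SR : gval R \in SubR R by apply: imset_f; rewrite inE.
split.
  apply/imsetP; exists (gval R) => //; apply/esym/setP=> L; rewrite inE.
  apply/imsetP/eqP=> [[a Aa ->] | ->].
    rewrite -[LHS]/(a @: R) -(actperm_SubRE Aa) //.
    have: actperm <[Aut_acts_SubR R]> a \in AR R by rewrite mem_morphim.
    by rewrite AR1 => /set1P->; rewrite perm1.
  by exists 1; rewrite ?group1 // act1.
split; last by move=> L _; rewrite AR1; apply/trivgP/subsetIl.
apply/imsetP; exists (gval R); first exact: set11.
by rewrite AR1 /orbit imset_set1 act1.
Qed.
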